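(* Let $\mathcal A$ be a regular category. The following are equivalent. (1) $\mathcal A$ is pronormal. (2) $\mathcal A$ is propointed and the slice category $\mathcal A/0$ is normal. (3) There exists a regular conservative right-adjoint functor $U\colon\mathcal A\to\mathcal X$ with $\mathcal X$ normal. (4) $\mathcal A$ admits an initial object and there exists a regular conservative functor $U\colon\mathcal A\to\mathcal X$ with $\mathcal X$ normal.
   Context: A finitely complete category is propointed if it admits an initial object $0$ and the unique morphism $0\to1$ is a universal extremal epimorphism (an extremal epimorphism all of whose pullbacks are extremal epimorphisms). In a category with an initial object $0$, a morphism $g\colon B\to C$ is a normal epimorphism if the pullback of $g$ along the unique morphism $0\to C$ exists and the resulting pullback square is also a pushout. A pronormal category is a propointed regular category in which every regular epimorphism is a normal epimorphism. A normal category is a pointed regular category in which every regular epimorphism is a normal epimorphism (i.e. the cokernel of its kernel). A category is pointed if it has a zero object. A functor is right-adjoint if it admits a left adjoint, conservative if it reflects isomorphisms; a regular functor between regular categories is one preserving finite limits and regular epimorphisms. *)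

(* Defs.v *)
(* Objects and morphisms live in fixed universes, shared by all categories below
   (finite diagram shapes included); they are closed under forming slices. *)
From Stdlib Require Import List ProofIrrelevance.

Set Implicit Arguments.
Unset Strict Implicit.
Unset Printing Implicit Defensive.

Declare Scope cat_scope.
Delimit Scope cat_scope with cat.
Local Open Scope cat_scope.

Record Category : Type := {
  Ob :> Type;
  Hom : Ob -> Ob -> Type;
  idm : forall x : Ob, Hom x x;
  comp : forall x y z : Ob, Hom y z -> Hom x y -> Hom x z;
  comp_idl : forall (x y : Ob) (f : Hom x y), comp (idm y) f = f;
  comp_idr : forall (x y : Ob) (f : Hom x y), comp f (idm x) = f;
  comp_assoc : forall (x y z w : Ob) (h : Hom z w) (g : Hom y z) (f : Hom x y),
    comp h (comp g f) = comp (comp h g) f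
}.

Arguments Hom {c} x y.
Arguments idm {c} x.
Arguments comp {c x y z} g f.

Notation "g ∘ f" := (comp g f) (at level 40, left associativity) : cat_scope.

Record Functor (A B : Category) : Type := {
  fob :> A -> B;
  fmap : forall x y : A, Hom x y -> Hom (fob x) (fob y);
  fmap_id : forall x : A, fmap (idm x) = idm (fob x);
  fmap_comp : forall (x y z : A) (g : Hom y z) (f : Hom x y),
    fmap (g ∘ f) = fmap g ∘ fmap f
}.

Arguments fmap {A B} f {x y} _ : rename.

Definition functor_comp (A B C : Category) (G : Functor B C) (F : Functor A B) :
  Functor A C.
Proof.
refine {| fob := fun x => G (F x);
          fmap := fun x y (f : Hom x y) => fmap G (fmap F f) |}.
- intro x; rewrite fmap_id; apply fmap_id.
- intros x y z g f; rewrite fmap_comp; apply fmap_comp.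
Defined.

Section Morphisms.
Variable A : Category.

Definition is_iso (x y : A) (f : Hom x y) : Prop :=
  exists g : Hom y x, g ∘ f = idm x /\ f ∘ g = idm y.

Definition is_mono (x y : A) (f : Hom x y) : Prop :=
  forall (w : A) (u v : Hom w x), f ∘ u = f ∘ v -> u = v.

Definition is_epi (x y : A) (f : Hom x y) : Prop :=
  forall (w : A) (u v : Hom y w), u ∘ f = v ∘ f -> u = v.

Definition is_extremal_epi (x y : A) (f : Hom x y) : Prop :=
  is_epi f /\
  forall (w : A) (m : Hom w y) (g : Hom x w), is_mono m -> f = m ∘ g -> is_iso m.

Definition is_initial (z : A) : Prop := forall x : A, exists! f : Hom z x, True.

Definition is_terminal (t : A) : Prop := forall x : A, exists! f : Hom x t, True.

(*       q
      p ---> y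
    p1|      | g
      v      v
      x ---> z
         f         *)
Definition is_pullback (x y z p : A) (f : Hom x z) (g : Hom y z)
    (p1 : Hom p x) (q : Hom p y) : Prop :=
  f ∘ p1 = g ∘ q /\
  forall (w : A) (u : Hom w x) (v : Hom w y), f ∘ u = g ∘ v ->
    exists! h : Hom w p, p1 ∘ h = u /\ q ∘ h = v.

(*       g
      x ---> z
     f|      | i2
      v      v
      y ---> p
         i1        *)
Definition is_pushout (x y z p : A) (f : Hom x y) (g : Hom x z)
    (i1 : Hom y p) (i2 : Hom z p) : Prop :=
  i1 ∘ f = i2 ∘ g /\
  forall (w : A) (u : Hom y w) (v : Hom z w), u ∘ f = v ∘ g ->
    exists! h : Hom p w, h ∘ i1 = u /\ h ∘ i2 = v.

Definition is_coequalizer (x y q : A) (a b : Hom x y) (e : Hom y q) : Prop :=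
  e ∘ a = e ∘ b /\
  forall (w : A) (u : Hom y w), u ∘ a = u ∘ b -> exists! h : Hom q w, h ∘ e = u.

Definition is_regular_epi (x y : A) (e : Hom x y) : Prop :=
  exists (w : A) (a b : Hom w x), is_coequalizer a b e.

Definition is_universal_extremal_epi (x y : A) (f : Hom x y) : Prop :=
  is_extremal_epi f /\
  forall (y' p : A) (g : Hom y' y) (p1 : Hom p x) (q : Hom p y'),
    is_pullback f g p1 q -> is_extremal_epi q.

(* The choice of the initial object and of the pullback is immaterial, both
   being unique up to isomorphism. *)
Definition is_normal_epi (B C : A) (g : Hom B C) : Prop :=
  exists (z : A) (i : Hom z C) (K : A) (k : Hom K B) (e : Hom K z),
    is_initial z /\ is_pullback g i k e /\ is_pushout k e g i.

End Morphisms.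

Record Cone (J A : Category) (D : Functor J A) : Type := {
  apex : A;
  leg : forall j : J, Hom apex (D j);
  leg_natural : forall (i j : J) (u : Hom i j), fmap D u ∘ leg i = leg j
}.

Arguments leg {J A D} c j : rename.

Definition is_limit (J A : Category) (D : Functor J A) (c : Cone D) : Prop :=
  forall c' : Cone D,
    exists! h : Hom (apex c') (apex c), forall j : J, leg c j ∘ h = leg c' j.

Definition map_cone (J A B : Category) (F : Functor A B) (D : Functor J A)
    (c : Cone D) : Cone (functor_comp F D).
Proof.
refine (@Build_Cone J B (functor_comp F D) (F (apex c))
          (fun j => fmap F (leg c j)) _).
intros i j u; simpl; rewrite <- fmap_comp; f_equal; apply leg_natural.
Defined.

Definition finite_type (T : Type) : Prop := exists l : list T, forall x : T, In x l.

Definition finite_category (J : Category) : Prop :=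
  finite_type J /\ forall i j : J, finite_type (Hom i j).

Definition finitely_complete (A : Category) : Prop :=
  forall J : Category, finite_category J ->
  forall D : Functor J A, exists c : Cone D, is_limit c.

Definition preserves_finite_limits (A B : Category) (F : Functor A B) : Prop :=
  forall J : Category, finite_category J ->
  forall (D : Functor J A) (c : Cone D), is_limit c -> is_limit (map_cone F c).

Definition regular_category (A : Category) : Prop :=
  finitely_complete A /\
  (forall (x y p : A) (f : Hom x y) (a b : Hom p x), is_pullback f f a b ->
     exists (q : A) (e : Hom x q), is_coequalizer a b e) /\
  (forall (x y y' p : A) (f : Hom x y) (g : Hom y' y)
          (p1 : Hom p x) (q : Hom p y'),
     is_pullback f g p1 q -> is_regular_epi f -> is_regular_epi q).

Definition has_initial (A : Category) : Prop := exists z : A, is_initial z.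

Definition pointed (A : Category) : Prop :=
  exists z : A, is_initial z /\ is_terminal z.

Definition propointed (A : Category) : Prop :=
  finitely_complete A /\
  exists (z t : A) (m : Hom z t),
    is_initial z /\ is_terminal t /\ is_universal_extremal_epi m.

Definition regular_epis_are_normal (A : Category) : Prop :=
  forall (B C : A) (g : Hom B C), is_regular_epi g -> is_normal_epi g.

Definition pronormal (A : Category) : Prop :=
  propointed A /\ regular_category A /\ regular_epis_are_normal A.

(* When the initial object is a zero object, [is_normal_epi g] says that [g] is
   the cokernel of its kernel. *)
Definition normal (A : Category) : Prop :=
  pointed A /\ regular_category A /\ regular_epis_are_normal A.

Section Slice.
Variables (A : Category) (s : A).

Record SliceOb : Type := { slice_dom : A; slice_arr : Hom slice_dom s }.

Definition SliceHom (x y : SliceOb) : Type :=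
  { f : Hom (slice_dom x) (slice_dom y) | slice_arr y ∘ f = slice_arr x }.

Lemma SliceHom_eq (x y : SliceOb) (f g : SliceHom x y) :
  proj1_sig f = proj1_sig g -> f = g.
Proof.
destruct f as [f hf], g as [g hg]; simpl; intro E; subst g.
f_equal; apply proof_irrelevance.
Qed.

Definition slice_id (x : SliceOb) : SliceHom x x :=
  exist _ (idm (slice_dom x)) (comp_idr (slice_arr x)).

Definition slice_comp (x y z : SliceOb) (g : SliceHom y z) (f : SliceHom x y) :
  SliceHom x z.
Proof.
exists (proj1_sig g ∘ proj1_sig f).
rewrite comp_assoc, (proj2_sig g); exact (proj2_sig f).
Defined.

Definition Slice : Category.
Proof.
refine {| Ob := SliceOb; Hom := SliceHom; idm := slice_id; comp := slice_comp |}.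
- intros x y f; apply SliceHom_eq, comp_idl.
- intros x y f; apply SliceHom_eq, comp_idr.
- intros x y z w h g f; apply SliceHom_eq, comp_assoc.
Defined.

End Slice.

Record Adjunction (X A : Category) (L : Functor X A) (U : Functor A X) : Type := {
  adj_unit : forall x : X, Hom x (U (L x));
  adj_counit : forall a : A, Hom (L (U a)) a;
  unit_natural : forall (x y : X) (f : Hom x y),
    fmap U (fmap L f) ∘ adj_unit x = adj_unit y ∘ f;
  counit_natural : forall (a b : A) (f : Hom a b),
    f ∘ adj_counit a = adj_counit b ∘ fmap L (fmap U f);
  triangle_left : forall x : X, adj_counit (L x) ∘ fmap L (adj_unit x) = idm (L x);
  triangle_right : forall a : A, fmap U (adj_counit a) ∘ adj_unit (U a) = idm (U a)
}.

Definition right_adjoint (A X : Category) (U : Functor A X) : Prop :=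
  exists L : Functor X A, inhabited (Adjunction L U).

Definition conservative (A X : Category) (U : Functor A X) : Prop :=
  forall (x y : A) (f : Hom x y), is_iso (fmap U f) -> is_iso f.

Definition regular_functor (A X : Category) (U : Functor A X) : Prop :=
  preserves_finite_limits U /\
  forall (x y : A) (f : Hom x y), is_regular_epi f -> is_regular_epi (fmap U f).

(* Main.v *)
(** A regular epimorphism [g : B -> C] is a normal epimorphism as soon as every
    [u : B -> T] that is trivial on the kernel of [g] coequalizes every pair
    coequalized by [g].  This is an equality of morphisms, so a faithful functor
    reflects it, and it holds after applying a functor into a normal category
    that preserves pullbacks and regular epimorphisms: this is (4) => (1).
    There [0 -> 1] is a universal extremal epimorphism because its image in a
    pointed category is a split epimorphism.  Conversely, when [0 -> 1] is a
    universal extremal epimorphism, the functor [- × 0] into the slice over [0]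
    is conservative and regular, and it is right adjoint to the domain
    functor. *)
From Stdlib Require Import List ProofIrrelevance Classical IndefiniteDescription.
Require Import Defs.

Set Implicit Arguments.
Unset Strict Implicit.
Unset Printing Implicit Defensive.
Local Open Scope cat_scope.

(** * Initial and terminal objects, monomorphisms, and extremal epimorphisms *)

Section UniversalProperties.
Variable A : Category.

Lemma initial_arr (z x : A) : is_initial z -> exists f : Hom z x, True.
Proof. intro hz; destruct (hz x) as [f _]; exists f; exact I. Qed.

Lemma initial_ext (z x : A) (f g : Hom z x) : is_initial z -> f = g.
Proof.
intro hz; destruct (hz x) as [h [_ hu]].
rewrite <- (hu f I); exact (hu g I).
Qed.

Lemma terminal_arr (t x : A) : is_terminal t -> exists f : Hom x t, True.
Proof. intro ht; destruct (ht x) as [f _]; exists f; exact I. Qed.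

Lemma terminal_ext (t x : A) (f g : Hom x t) : is_terminal t -> f = g.
Proof.
intro ht; destruct (ht x) as [h [_ hu]].
rewrite <- (hu f I); exact (hu g I).
Qed.

Lemma pullback_ext (x y z p : A) (f : Hom x z) (g : Hom y z)
    (p1 : Hom p x) (q : Hom p y) (w : A) (h h' : Hom w p) :
  is_pullback f g p1 q -> p1 ∘ h = p1 ∘ h' -> q ∘ h = q ∘ h' -> h = h'.
Proof.
intros [hc hp] e1 e2.
destruct (hp w (p1 ∘ h) (q ∘ h)) as [k [_ hu]].
- rewrite !comp_assoc, hc; reflexivity.
- rewrite <- (hu h (conj eq_refl eq_refl)).
  apply hu; split; symmetry; assumption.
Qed.

(** This form makes it evident that a functor preserving pullbacks preserves monomorphisms. *)
Lemma mono_pullback (x y : A) (m : Hom x y) :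
  is_mono m <-> is_pullback m m (idm x) (idm x).
Proof.
split.
- intro hm; split; [reflexivity|].
  intros w u v e; exists u; split.
  + rewrite !comp_idl; split; [reflexivity | exact (hm w u v e)].
  + intros h [e1 _]; rewrite comp_idl in e1; symmetry; exact e1.
- intros [_ hp] w u v e.
  destruct (hp w u v e) as [h [[e1 e2] _]].
  rewrite <- e1; exact e2.
Qed.

Lemma regular_epi_epi (x y : A) (e : Hom x y) : is_regular_epi e -> is_epi e.
Proof.
intros [w [a [b [hc he]]]] t u v huv.
destruct (he t (u ∘ e)) as [h [_ hu]].
- rewrite <- !comp_assoc, hc; reflexivity.
- rewrite <- (hu u eq_refl); apply hu; symmetry; exact huv.
Qed.

Lemma mono_split_epi_iso (x y : A) (m : Hom x y) (s : Hom y x) :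
  is_mono m -> m ∘ s = idm y -> is_iso m.
Proof.
intros hm e; exists s; split; [|exact e].
apply hm; rewrite comp_assoc, e, comp_idl, comp_idr; reflexivity.
Qed.

Lemma extremal_epi_of_comp (x y z : A) (f : Hom y z) (g : Hom x y) :
  is_extremal_epi (f ∘ g) -> is_extremal_epi f.
Proof.
intros [he hx]; split.
- intros w u v e; apply he; rewrite !comp_assoc, e; reflexivity.
- intros w m h hm e; apply (hx w m (h ∘ g) hm).
  rewrite comp_assoc, <- e; reflexivity.
Qed.

Lemma extremal_epi_comp_iso (x y z : A) (f : Hom y z) (g : Hom x y) :
  is_extremal_epi f -> is_iso g -> is_extremal_epi (f ∘ g).
Proof.
intros hf [g' [_ e]]; apply (extremal_epi_of_comp (g := g')).
rewrite <- comp_assoc, e, comp_idr; exact hf.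
Qed.

End UniversalProperties.

(** * Finite shapes, and diagrams in a slice *)

Section Diagrams.

(** With equality proofs as morphisms, the laws follow from proof irrelevance; excluded middle then
    shows that each hom-set is finite. *)
Definition discrete (T : Type) : Category.
Proof.
refine {| Ob := T; Hom := fun i j => i = j; idm := fun i => eq_refl;
          comp := fun i j k (g : j = k) (f : i = j) => eq_trans f g |};
intros; apply proof_irrelevance.
Defined.

Definition discrete_diagram (T : Type) (A : Category) (F : T -> A) :
  Functor (discrete T) A.
Proof.
refine (@Build_Functor (discrete T) A F
          (fun i j (e : i = j) =>
             match e in _ = k return Hom (F i) (F k) with
             | eq_refl => idm (F i) end) _ _).
- intro x; reflexivity.
- intros x y z g f; destruct g, f; symmetry; apply comp_idl.
Defined.

Lemma finite_discrete (T : Type) : finite_type T -> finite_category (discrete T).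
Proof.
intro hT; split; [exact hT|].
intros i j.
destruct (classic (i = j)) as [e | n].
- exists (e :: nil); intro e'; left; exact (proof_irrelevance (i = j) e e').
- exists nil; intro e'; destruct (n e').
Qed.

Variable J : Category.

(** [None] is a freely adjoined terminal object. A diagram of shape [J] in the slice over [z]
    amounts to a diagram of the enlarged shape in [A] with [z] at [None]. *)
Definition with_top_hom (i j : option J) : Type :=
  match i, j with
  | Some i, Some j => Hom i j
  | None, Some _ => Empty_set
  | _, None => unit
  end.

Definition with_top : Category.
Proof.
unshelve refine {| Ob := option J; Hom := with_top_hom |}.
- intros [x|]; [exact (idm x) | exact tt].
- intros [x|] [y|] [z|]; simpl; intros g f;
    first [exact (g ∘ f) | exact tt | destruct g | destruct f].
- intros [x|] [y|]; simpl; intro f;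
    [apply comp_idl | destruct f; reflexivity ..].
- intros [x|] [y|]; simpl; intro f;
    [apply comp_idr | destruct f; reflexivity ..].
- intros [x|] [y|] [z|] [w|]; simpl; intros h g f;
    first [apply comp_assoc | reflexivity | destruct h | destruct g | destruct f].
Defined.

Lemma finite_with_top : finite_category J -> finite_category with_top.
Proof.
intros [[l hl] hH]; split.
- exists (None :: map Some l).
  intros [x|]; [right; apply in_map, hl | left; reflexivity].
- intros [x|] [y|]; simpl.
  + apply hH.
  + exists (tt :: nil); intros []; left; reflexivity.
  + exists nil; intros [].
  + exists (tt :: nil); intros []; left; reflexivity.
Qed.

Definition slice_diagram (A : Category) (z : A) (D : Functor J (Slice z)) :
  Functor with_top A.
Proof.
unshelve refine (@Build_Functor with_top A
  (fun o => match o with Some j => slice_dom (D j) | None => z end) _ _ _).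
- intros [i|] [j|]; simpl; intro u.
  + exact (proj1_sig (fmap D u)).
  + exact (slice_arr (D i)).
  + destruct u.
  + exact (idm z).
- intros [i|]; simpl; [rewrite fmap_id|]; reflexivity.
- intros [i|] [j|] [k|]; simpl; intros v u; try destruct u; try destruct v.
  + rewrite fmap_comp; reflexivity.
  + symmetry; exact (proj2_sig (fmap D u)).
  + symmetry; apply comp_idl.
  + symmetry; apply comp_idl.
Defined.

End Diagrams.

(** * Limits in slices; pullbacks, terminal objects and equalizers as limits *)

Section FiniteLimits.
Variable A : Category.

(** A limit in the slice is a limit in [A] of the diagram with [z] adjoined at the top; its leg at
    [None] is the structure map to [z]. *)
Lemma slice_finitely_complete (z : A) :
  finitely_complete A -> finitely_complete (Slice z).
Proof.
intros hA J hJ D.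
destruct (hA (with_top J) (finite_with_top hJ) (slice_diagram D)) as [c hc].
unshelve eexists (@Build_Cone J (Slice z) D
  (@Build_SliceOb A z (apex c) (leg c (None : with_top J)))
  (fun j => exist _ (leg c (Some j : with_top J)) _) _).
- exact (leg_natural c (tt : @Hom (with_top J) (Some j) None)).
- intros i j u; apply SliceHom_eq.
  exact (leg_natural c (u : @Hom (with_top J) (Some i) (Some j))).
- intro c'.
  unshelve epose (d := @Build_Cone (with_top J) A (slice_diagram D)
    (slice_dom (apex c'))
    (fun o => match o with
              | Some j => proj1_sig (leg c' j)
              | None => slice_arr (apex c') end) _).
  { intros [i|] [j|] u; simpl.
    - exact (f_equal (@proj1_sig _ _) (leg_natural c' u)).
    - exact (proj2_sig (leg c' i)).
    - destruct u.
    - apply comp_idl. }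
  destruct (hc d) as [h [hh hu]].
  exists (exist _ h (hh None)); split.
  + intro j; apply SliceHom_eq; exact (hh (Some j)).
  + intros k hk; apply SliceHom_eq; simpl; apply hu.
    intros [j|]; simpl.
    * exact (f_equal (@proj1_sig _ _) (hk j)).
    * exact (proj2_sig k).
Qed.

Definition cospan : Category := with_top (discrete bool).

Lemma finite_cospan : finite_category cospan.
Proof.
apply finite_with_top, finite_discrete.
exists (true :: false :: nil); intros []; simpl; tauto.
Qed.

Definition cospan_arr (b : bool) : @Hom cospan (Some b) None := tt.

Definition cospan_cone (D : Functor cospan A) (w : A)
    (u : Hom w (D (Some true))) (v : Hom w (D (Some false))) :
  fmap D (cospan_arr true) ∘ u = fmap D (cospan_arr false) ∘ v -> Cone D.
Proof.
intro e.
refine (@Build_Cone cospan A D w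
  (fun o => match o with
            | Some true => u
            | Some false => v
            | None => fmap D (cospan_arr true) ∘ u end) _).
intros i j h.
assert (hid : forall (o : cospan) (k : Hom w (D o)), fmap D (idm o) ∘ k = k)
  by (intros; rewrite fmap_id; apply comp_idl).
destruct i as [b|], j as [b'|].
- simpl in h; destruct h; apply (hid (Some b)).
- destruct h, b; [reflexivity | symmetry; exact e].
- destruct h.
- destruct h; apply (hid None).
Defined.

(** The diagram [D] is arbitrary so that the equivalence also applies to the image of a cospan under
    a functor. The leg at [None] carries no information, being a composite of either other leg. *)
Lemma limit_cospan_pullback (D : Functor cospan A) (c : Cone D) :
  is_limit c <->
  is_pullback (fmap D (cospan_arr true)) (fmap D (cospan_arr false))
    (leg c (Some true : cospan)) (leg c (Some false : cospan)).
Proof.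
split.
- intro hc; split.
  + rewrite !leg_natural; reflexivity.
  + intros w u v e.
    destruct (hc (cospan_cone e)) as [h [hh hu]].
    exists h; split.
    * exact (conj (hh (Some true)) (hh (Some false))).
    * intros k [e1 e2]; apply hu.
      intros [[]|]; [exact e1 | exact e2 |].
      rewrite <- (leg_natural c (cospan_arr true)).
      simpl; rewrite <- e1, comp_assoc; reflexivity.
- intros [_ hp] c'.
  destruct (hp _ (leg c' (Some true : cospan)) (leg c' (Some false : cospan)))
    as [h [[e1 e2] hu]].
  + rewrite !leg_natural; reflexivity.
  + exists h; split.
    * intros [[]|]; [exact e1 | exact e2 |].
      rewrite <- (leg_natural c (cospan_arr true)).
      rewrite <- (leg_natural c' (cospan_arr true)).
      rewrite <- comp_assoc; f_equal; exact e1.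
    * intros k hk; apply hu; split; apply hk.
Qed.

(** A cospan with vertex [z] is a discrete pair of objects of the slice over [z]. *)
Definition cospan_diagram (x y z : A) (f : Hom x z) (g : Hom y z) :
  Functor cospan A :=
  slice_diagram (discrete_diagram (A := Slice z) (fun b : bool =>
    if b then Build_SliceOb f else Build_SliceOb g)).

Lemma pullback_exists (x y z : A) (f : Hom x z) (g : Hom y z) :
  finitely_complete A ->
  exists (p : A) (p1 : Hom p x) (q : Hom p y), is_pullback f g p1 q.
Proof.
intro hA.
destruct (hA cospan finite_cospan (cospan_diagram f g)) as [c hc].
apply limit_cospan_pullback in hc.
exists (apex c), (leg c (Some true : cospan)), (leg c (Some false : cospan)).
exact hc.
Qed.

Lemma finite_empty : finite_category (discrete Empty_set).
Proof. apply finite_discrete; exists nil; intros []. Qed.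

Lemma limit_empty_terminal (D : Functor (discrete Empty_set) A) (c : Cone D) :
  is_limit c <-> is_terminal (apex c).
Proof.
split.
- intros hc x.
  destruct (hc (@Build_Cone (discrete Empty_set) A D x
    (fun j => match j with end) (fun i => match i with end))) as [h [_ hu]].
  exists h; split; [exact I|].
  intros k _; apply hu; intros [].
- intros ht c'; destruct (ht (apex c')) as [h [_ hu]].
  exists h; split; [intros []|].
  intros k _; apply hu; exact I.
Qed.

Lemma terminal_exists : finitely_complete A -> exists t : A, is_terminal t.
Proof.
intro hA.
destruct (hA _ finite_empty (discrete_diagram (fun e : Empty_set => match e with end)))
  as [c hc].
exists (apex c); apply limit_empty_terminal; exact hc.
Qed.

(** The source is [false], the target is [true], and the two arrows between them are again indexed
    by booleans. *)
Definition parallel_hom (i j : bool) : Set :=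
  match i, j with
  | false, true => bool
  | true, false => Empty_set
  | _, _ => unit
  end.

Definition parallel_pair : Category.
Proof.
unshelve refine {| Ob := bool; Hom := parallel_hom |}.
- intros []; exact tt.
- intros [] [] []; simpl; intros g f;
    first [exact tt | destruct g; fail | destruct f; fail | exact f | exact g].
- intros [] [] []; reflexivity.
- intros [] [] []; reflexivity.
- intros [] [] [] []; simpl; intros h g f;
    first [reflexivity | destruct h; fail | destruct g; fail | destruct f; fail].
Defined.

Lemma finite_parallel_pair : finite_category parallel_pair.
Proof.
split.
- exists (true :: false :: nil); intros []; simpl; tauto.
- intros [] []; simpl.
  + exists (tt :: nil); intros []; left; reflexivity.
  + exists nil; intros [].
  + exists (true :: false :: nil); intros []; simpl; tauto.
  + exists (tt :: nil); intros []; left; reflexivity.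
Qed.

Definition parallel_arr (b : bool) : @Hom parallel_pair false true := b.

Definition parallel_diagram (x y : A) (f g : Hom x y) : Functor parallel_pair A.
Proof.
unshelve refine (@Build_Functor parallel_pair A
  (fun o => if o then y else x) _ _ _).
- intros [] []; simpl; intro u;
    [exact (idm y) | destruct u | exact (if u then f else g) | exact (idm x)].
- intros []; reflexivity.
- intros [] [] []; simpl; intros v u;
    first [symmetry; apply comp_idl | symmetry; apply comp_idr
          | destruct u; fail | destruct v; fail].
Defined.

Definition parallel_cone (D : Functor parallel_pair A) (w : A)
    (u : Hom w (D false)) :
  fmap D (parallel_arr true) ∘ u = fmap D (parallel_arr false) ∘ u -> Cone D.
Proof.
intro e.
refine (@Build_Cone parallel_pair A D w
  (fun o => match o with
            | false => u
            | true => fmap D (parallel_arr true) ∘ u end) _).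
assert (hid : forall (o : parallel_pair) (k : Hom w (D o)), fmap D (idm o) ∘ k = k)
  by (intros; rewrite fmap_id; apply comp_idl).
intros [] [] h.
- destruct h; apply (hid true).
- destruct h.
- destruct h; [reflexivity | symmetry; exact e].
- destruct h; apply (hid false).
Defined.

(** The leg at [true] is a composite of the leg at [false], so the latter alone determines a
    morphism into the limit. *)
Lemma limit_parallel_mono (D : Functor parallel_pair A) (c : Cone D) :
  is_limit c -> is_mono (leg c (false : parallel_pair)).
Proof.
intros hc w u v e.
assert (ec : fmap D (parallel_arr true) ∘ (leg c (false : parallel_pair) ∘ v) =
             fmap D (parallel_arr false) ∘ (leg c (false : parallel_pair) ∘ v))
  by (rewrite !comp_assoc, !leg_natural; reflexivity).
destruct (hc (parallel_cone ec)) as [h [_ hu]].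
assert (key : forall k, leg c (false : parallel_pair) ∘ k =
                        leg c (false : parallel_pair) ∘ v -> h = k).
{ intros k ek; apply hu; intros [].
  - simpl; rewrite <- (leg_natural c (parallel_arr true)), <- comp_assoc.
    f_equal; exact ek.
  - exact ek. }
rewrite <- (key u e); apply key; reflexivity.
Qed.

End FiniteLimits.

(** * Right adjoints, and conservative functors preserving finite limits *)

Section Functors.
Variables (A X : Category) (U : Functor A X).

Lemma fmap_iso (x y : A) (f : Hom x y) : is_iso f -> is_iso (fmap U f).
Proof.
intros [g [e1 e2]]; exists (fmap U g).
rewrite <- !fmap_comp, e1, e2, !fmap_id; split; reflexivity.
Qed.

(** A cone over the image diagram transposes to a cone over [D] with apex [L (apex c')]; the
    mediating morphism is transposed back. *)
Lemma right_adjoint_preserves_limits :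
  right_adjoint U -> preserves_finite_limits U.
Proof.
intros [L [adj]] J _ D c hc c'.
unshelve epose (d := @Build_Cone J A D (L (apex c'))
  (fun j => adj_counit adj (D j) ∘ fmap L (leg c' j)) _).
{ intros i j u; simpl.
  rewrite comp_assoc, (counit_natural adj), <- comp_assoc, <- fmap_comp.
  do 2 f_equal; exact (leg_natural c' u). }
destruct (hc d) as [h [hh hu]].
exists (fmap U h ∘ adj_unit adj (apex c')); split.
- intro j; simpl.
  etransitivity; [apply comp_assoc|].
  etransitivity; [exact (f_equal (fun k => k ∘ _) (eq_sym (fmap_comp U (leg c j) h)))|].
  rewrite (hh j); simpl.
  rewrite fmap_comp, <- comp_assoc.
  etransitivity; [exact (f_equal _ (unit_natural adj (leg c' j)))|].
  rewrite comp_assoc; simpl; rewrite triangle_right; apply comp_idl.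
- intros k hk.
  (* The transpose of a competitor [k] also mediates the transposed cone, hence equals [h]. *)
  assert (e : h = adj_counit adj (apex c) ∘ fmap L k).
  { apply hu; intro j; simpl.
    rewrite comp_assoc, (counit_natural adj), <- comp_assoc, <- fmap_comp.
    do 2 f_equal; exact (hk j). }
  rewrite e, fmap_comp, <- comp_assoc, (unit_natural adj), comp_assoc.
  simpl; rewrite triangle_right; apply comp_idl.
Qed.

Lemma left_adjoint_initial (z : X) (L : Functor X A) (adj : Adjunction L U) :
  is_initial z -> is_initial (L z).
Proof.
intros hz a.
destruct (initial_arr (U a) hz) as [f _].
exists (adj_counit adj a ∘ fmap L f); split; [exact I|].
intros g _.
rewrite (initial_ext f (fmap U g ∘ adj_unit adj z) hz).
rewrite fmap_comp, comp_assoc, <- (counit_natural adj), <- comp_assoc.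
rewrite triangle_left; apply comp_idr.
Qed.

Hypothesis hU : preserves_finite_limits U.

Lemma preserves_pullback (x y z p : A) (f : Hom x z) (g : Hom y z)
    (p1 : Hom p x) (q : Hom p y) :
  is_pullback f g p1 q ->
  is_pullback (fmap U f) (fmap U g) (fmap U p1) (fmap U q).
Proof.
intro hp.
pose (c := @cospan_cone A (cospan_diagram f g) p p1 q (proj1 hp)).
assert (hc : is_limit c) by (apply limit_cospan_pullback; exact hp).
apply (hU finite_cospan) in hc.
apply limit_cospan_pullback in hc; exact hc.
Qed.

Lemma preserves_mono (x y : A) (m : Hom x y) : is_mono m -> is_mono (fmap U m).
Proof.
rewrite !mono_pullback; intro hm.
apply preserves_pullback in hm; rewrite fmap_id in hm; exact hm.
Qed.

Lemma preserves_terminal (t : A) : is_terminal t -> is_terminal (U t).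
Proof.
intro ht.
pose (c := @Build_Cone (discrete Empty_set) A
  (discrete_diagram (fun e : Empty_set => match e with end)) t
  (fun j => match j with end) (fun i => match i with end)).
assert (hc : is_limit c) by (apply limit_empty_terminal; exact ht).
apply (hU finite_empty) in hc.
apply limit_empty_terminal in hc; exact hc.
Qed.

Hypothesis hA : finitely_complete A.
Hypothesis hC : conservative U.

(* The equalizer of [f] and [g] becomes invertible under [U]. *)
Lemma conservative_faithful (x y : A) (f g : Hom x y) :
  fmap U f = fmap U g -> f = g.
Proof.
intro e.
destruct (hA finite_parallel_pair (parallel_diagram f g)) as [c hc].
assert (hm := limit_parallel_mono hc).
assert (efg : f ∘ leg c (false : parallel_pair) = g ∘ leg c (false : parallel_pair)).
{ transitivity (leg c (true : parallel_pair)).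
  - exact (leg_natural c (parallel_arr true)).
  - symmetry; exact (leg_natural c (parallel_arr false)). }
assert (hi : is_iso (leg c (false : parallel_pair))).
{ apply hC.
  (* The identity of [U x] equalizes the two equal images, so it factors through the image of the
     equalizer: this monomorphism has a section. *)
  unshelve epose (d := @parallel_cone X (functor_comp U (parallel_diagram f g))
    (U x) (idm (U x)) _).
  { exact (f_equal (fun h => h ∘ idm (U x)) e). }
  destruct (hU finite_parallel_pair hc d) as [s [hs _]].
  apply (mono_split_epi_iso (s := s)).
  - exact (preserves_mono hm).
  - exact (hs (false : parallel_pair)). }
destruct hi as [s [_ es]].
rewrite <- (comp_idr f), <- (comp_idr g).
change (f ∘ idm (parallel_diagram f g false) = g ∘ idm (parallel_diagram f g false)).
rewrite <- es.
change (f ∘ (leg c (false : parallel_pair) ∘ s) = g ∘ (leg c (false : parallel_pair) ∘ s)).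
etransitivity; [apply comp_assoc|].
etransitivity; [|symmetry; apply comp_assoc].
f_equal; exact efg.
Qed.

(** Faithfulness reflects the cancellation of the split epimorphism [fmap U f]. If [f] factors
    through a monomorphism [m], then [fmap U m] is a monomorphism with a section, and conservativity
    makes [m] invertible. *)
Lemma reflects_split_epi (x y : A) (f : Hom x y) (s : Hom (U y) (U x)) :
  fmap U f ∘ s = idm (U y) -> is_extremal_epi f.
Proof.
intro e; split.
- intros w u v huv; apply conservative_faithful.
  rewrite <- (comp_idr (fmap U u)), <- (comp_idr (fmap U v)), <- e.
  rewrite !comp_assoc, <- !fmap_comp, huv; reflexivity.
- intros w m g hm em; apply hC.
  apply (mono_split_epi_iso (s := fmap U g ∘ s)).
  + exact (preserves_mono hm).
  + rewrite comp_assoc, <- fmap_comp, <- em; exact e.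
Qed.

End Functors.

(** * Transfer of regularity and normality to a slice *)

Section SliceTransfer.
Variables (A : Category) (z : A).

Definition slice_mk (x : Slice z) (w : A) (f : Hom w (slice_dom x)) :
  @Hom (Slice z) (Build_SliceOb (slice_arr x ∘ f)) x :=
  exist _ f eq_refl.

(** A test object of [A] acquires a structure map to [z] through its morphism to [x]; commutativity
    over [c] makes the morphism to [y] compatible with it. *)
Lemma slice_pullback (x y c p : Slice z) (f : Hom x c) (g : Hom y c)
    (p1 : Hom p x) (q : Hom p y) :
  is_pullback f g p1 q <->
  is_pullback (proj1_sig f) (proj1_sig g) (proj1_sig p1) (proj1_sig q).
Proof.
split.
- intros [hc hp]; split; [exact (f_equal (@proj1_sig _ _) hc)|].
  intros w u v e.
  assert (ev : slice_arr y ∘ v = slice_arr x ∘ u).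
  { rewrite <- (proj2_sig f), <- (proj2_sig g), <- !comp_assoc, e; reflexivity. }
  destruct (hp _ (slice_mk u) (exist _ v ev)) as [h [[e1 e2] hu]].
  { apply SliceHom_eq; exact e. }
  exists (proj1_sig h); split.
  + split; [exact (f_equal (@proj1_sig _ _) e1) | exact (f_equal (@proj1_sig _ _) e2)].
  + intros k [k1 k2].
    assert (ek : slice_arr p ∘ k = slice_arr x ∘ u).
    { rewrite <- (proj2_sig p1), <- comp_assoc; f_equal; exact k1. }
    apply (f_equal (@proj1_sig _ _)) with (y := exist _ k ek).
    apply hu; split; apply SliceHom_eq; assumption.
- intros [hc hp]; split; [apply SliceHom_eq; exact hc|].
  intros w u v e.
  destruct (hp _ _ _ (f_equal (@proj1_sig _ _) e)) as [h [[e1 e2] hu]].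
  assert (eh : slice_arr p ∘ h = slice_arr w).
  { rewrite <- (proj2_sig p1), <- comp_assoc, e1; exact (proj2_sig u). }
  exists (exist _ h eh); split.
  + split; apply SliceHom_eq; assumption.
  + intros k [k1 k2]; apply SliceHom_eq; apply hu.
    split; [exact (f_equal (@proj1_sig _ _) k1) | exact (f_equal (@proj1_sig _ _) k2)].
Qed.

(** The factorization found in [A] is automatically over [z], since [e] is an epimorphism of [A]. *)
Lemma slice_coequalizer (w x q : Slice z) (a b : Hom w x) (e : Hom x q) :
  is_coequalizer (proj1_sig a) (proj1_sig b) (proj1_sig e) -> is_coequalizer a b e.
Proof.
intros he; assert (hepi : is_epi (proj1_sig e)).
{ apply regular_epi_epi; do 3 eexists; exact he. }
destruct he as [hc he].
split; [apply SliceHom_eq; exact hc|].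
intros t u hu.
destruct (he _ _ (f_equal (@proj1_sig _ _) hu)) as [h [eh hh]].
assert (es : slice_arr t ∘ h = slice_arr q).
{ apply hepi; rewrite <- comp_assoc, eh, (proj2_sig u), (proj2_sig e); reflexivity. }
exists (exist _ h es); split.
- apply SliceHom_eq; exact eh.
- intros k ek; apply SliceHom_eq, hh; exact (f_equal (@proj1_sig _ _) ek).
Qed.

Lemma slice_pushout (x y c p : Slice z) (f : Hom x y) (g : Hom x c)
    (i1 : Hom y p) (i2 : Hom c p) :
  is_pushout (proj1_sig f) (proj1_sig g) (proj1_sig i1) (proj1_sig i2) ->
  is_pushout f g i1 i2.
Proof.
intros [hc hp]; split; [apply SliceHom_eq; exact hc|].
intros w u v e.
destruct (hp _ _ _ (f_equal (@proj1_sig _ _) e)) as [h [[e1 e2] hu]].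
assert (eh : slice_arr w ∘ h = slice_arr p).
(* Both sides are mediating morphisms for the cocone of structure maps to [z]. *)
{ destruct (hp _ (slice_arr y) (slice_arr c)) as [k [_ hk]].
  - rewrite (proj2_sig f), (proj2_sig g); reflexivity.
  - rewrite <- (hk (slice_arr p) (conj (proj2_sig i1) (proj2_sig i2))).
    symmetry; apply hk; rewrite <- !comp_assoc, e1, e2.
    exact (conj (proj2_sig u) (proj2_sig v)). }
exists (exist _ h eh); split.
- split; apply SliceHom_eq; assumption.
- intros k [k1 k2]; apply SliceHom_eq, hu.
  split; [exact (f_equal (@proj1_sig _ _) k1) | exact (f_equal (@proj1_sig _ _) k2)].
Qed.

(* A morphism [u] of [A] out of an object over [z] becomes a morphism over [z]
   with values in the product of its codomain with [z]. *)
Lemma slice_regular_epi (x y : Slice z) (e : Hom x y) :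
  finitely_complete A -> is_regular_epi e <-> is_regular_epi (proj1_sig e).
Proof.
intro hA; split.
- intros [w [a [b [hc he]]]].
  exists (slice_dom w), (proj1_sig a), (proj1_sig b).
  split; [exact (f_equal (@proj1_sig _ _) hc)|].
  intros t u hu.
  destruct (terminal_exists hA) as [o ho].
  destruct (terminal_arr t ho) as [ot _], (terminal_arr z ho) as [oz _].
  destruct (pullback_exists ot oz hA) as [p [p1 [p2 hp]]].
  destruct (proj2 hp _ u (slice_arr x) (terminal_ext _ _ ho)) as [k [[k1 k2] _]].
  pose (T := Build_SliceOb p2 : Slice z).
  assert (hk : k ∘ proj1_sig a = k ∘ proj1_sig b).
  { apply (pullback_ext hp); rewrite !comp_assoc.
    - rewrite k1; exact hu.
    - rewrite k2, (proj2_sig a), (proj2_sig b); reflexivity. }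
  destruct (he T (exist _ k k2)) as [h [eh hh]].
  { apply SliceHom_eq; exact hk. }
  apply (f_equal (@proj1_sig _ _)) in eh; simpl in eh.
  exists (p1 ∘ proj1_sig h); split.
  + rewrite <- comp_assoc; exact (eq_trans (f_equal (comp p1) eh) k1).
  + intros h' eh'.
    destruct (proj2 hp _ h' (slice_arr y) (terminal_ext _ _ ho)) as [l [[l1 l2] _]].
    rewrite (hh (exist _ l l2 : @Hom (Slice z) y T)); [exact l1|].
    apply SliceHom_eq; simpl.
    apply (pullback_ext hp); rewrite comp_assoc.
    * rewrite l1, k1; exact eh'.
    * rewrite l2, k2; exact (proj2_sig e).
- intros [w [a [b he]]].
  (* Since [e] lies over [z] and coequalizes [a] and [b], these give their source the same structure
     map and become parallel in the slice. *)
  assert (eb : slice_arr x ∘ b = slice_arr x ∘ a).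
  { rewrite <- (proj2_sig e), <- !comp_assoc, (proj1 he); reflexivity. }
  exists (Build_SliceOb (slice_arr x ∘ a)), (slice_mk a), (exist _ b eb).
  apply slice_coequalizer; exact he.
Qed.

Lemma slice_regular : regular_category A -> regular_category (Slice z).
Proof.
intros [hA [hq hs]]; split; [|split].
- apply slice_finitely_complete, hA.
- intros x y p f a b hp.
  apply slice_pullback in hp.
  destruct (hq _ _ _ _ _ _ hp) as [q [e he]].
  (* The structure map of [x] coequalizes the kernel pair, so it descends to a structure map [r] of
     the quotient. *)
  destruct (proj2 he z (slice_arr x)) as [r [er _]].
  { rewrite (proj2_sig a), (proj2_sig b); reflexivity. }
  exists (Build_SliceOb r), (exist _ e er).
  apply slice_coequalizer; exact he.
- intros x y y' p f g p1 q hp.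
  rewrite !(slice_regular_epi _ hA); apply hs with (g := proj1_sig g) (p1 := proj1_sig p1).
  apply slice_pullback; exact hp.
Qed.

Lemma slice_over_initial (i : Slice z) : is_initial (slice_dom i) -> is_initial i.
Proof.
intros hi x; destruct (initial_arr (slice_dom x) hi) as [f _].
exists (exist _ f (initial_ext (slice_arr x ∘ f) (slice_arr i) hi) : SliceHom i x); split; [exact I|].
intros g _; apply SliceHom_eq, initial_ext, hi.
Qed.

Lemma slice_terminal : is_terminal (Build_SliceOb (idm z) : Slice z).
Proof.
intro x; exists (exist _ (slice_arr x) (comp_idl (slice_arr x)) :
    SliceHom x (Build_SliceOb (idm z))); split; [exact I|].
intros [g eg] _; apply SliceHom_eq; simpl in *.
rewrite <- eg; apply comp_idl.
Qed.

(** The identity of [z] is a zero object of the slice because [z] is initial. The square witnessing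
    normality in [A] lies over [z], and it remains a pullback and a pushout there. *)
Lemma slice_normal :
  is_initial z -> regular_category A -> regular_epis_are_normal A ->
  normal (Slice z).
Proof.
intros hz hA hn; split; [|split].
- exists (Build_SliceOb (idm z)); split.
  + apply slice_over_initial; exact hz.
  + apply slice_terminal.
- apply slice_regular, hA.
- intros B C g hg.
  apply (slice_regular_epi _ (proj1 hA)), hn in hg.
  destruct hg as [o [i [K [k [e [ho [hp hq]]]]]]].
  assert (ee : (slice_arr C ∘ i) ∘ e = slice_arr B ∘ k).
  { rewrite <- comp_assoc, <- (proj1 hp), comp_assoc, (proj2_sig g); reflexivity. }
  exists (Build_SliceOb (slice_arr C ∘ i)), (slice_mk i),
    (Build_SliceOb (slice_arr B ∘ k)), (slice_mk k), (exist _ e ee).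
  split; [|split].
  + apply slice_over_initial; exact ho.
  + apply slice_pullback; exact hp.
  + apply slice_pushout; exact hq.
Qed.

Definition slice_forget : Functor (Slice z) A :=
  @Build_Functor (Slice z) A (@slice_dom A z)
    (fun x y (f : SliceHom x y) => proj1_sig f)
    (fun x => eq_refl) (fun x y w g f => eq_refl).

End SliceTransfer.

(** * The functor taking products with [z], valued in the slice over [z] *)

Section ProductFunctor.
Variables (A : Category) (z : A) (P : A -> A).
Variables (pr1 : forall x, Hom (P x) x) (pr2 : forall x, Hom (P x) z).
Variable pairing : forall w x : A, Hom w x -> Hom w z -> Hom w (P x).
Hypothesis pairing1 : forall w x (f : Hom w x) (r : Hom w z),
  pr1 x ∘ pairing f r = f.
Hypothesis pairing2 : forall w x (f : Hom w x) (r : Hom w z),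
  pr2 x ∘ pairing f r = r.
Hypothesis pairing_ext : forall w x (h h' : Hom w (P x)),
  pr1 x ∘ h = pr1 x ∘ h' -> pr2 x ∘ h = pr2 x ∘ h' -> h = h'.

(** Products enter as chosen data because a functor needs a function on objects, whereas finite
    completeness only asserts existence. *)
Definition prod_functor : Functor A (Slice z).
Proof.
unshelve refine (@Build_Functor A (Slice z) (fun x => Build_SliceOb (pr2 x))
  (fun x y f => exist _ (pairing (f ∘ pr1 x) (pr2 x)) (pairing2 _ _)) _ _).
- intro x; apply SliceHom_eq; simpl.
  apply pairing_ext; rewrite ?pairing1, ?pairing2, ?comp_idl, ?comp_idr; reflexivity.
- intros x y w g f; apply SliceHom_eq; simpl.
  apply pairing_ext; rewrite !comp_assoc, ?pairing1, ?pairing2.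
  + rewrite <- !comp_assoc, pairing1; reflexivity.
  + reflexivity.
Defined.

(** The unit is the graph of a structure map, and the counit is the first projection. *)
Lemma prod_functor_right_adjoint : right_adjoint prod_functor.
Proof.
exists (slice_forget z); constructor.
unshelve refine (@Build_Adjunction (Slice z) A (slice_forget z) prod_functor
  (fun x => exist _ (pairing (idm (slice_dom x)) (slice_arr x)) (pairing2 _ _))
  pr1 _ _ _ _).
- intros x y f; apply SliceHom_eq; simpl.
  apply pairing_ext; rewrite !comp_assoc, ?pairing1, ?pairing2.
  + rewrite <- comp_assoc, pairing1, comp_idl, comp_idr; reflexivity.
  + symmetry; exact (proj2_sig f).
- intros a b f; symmetry; apply pairing1.
- intro x; apply pairing1.
- intro a; apply SliceHom_eq; simpl.
  apply pairing_ext; rewrite !comp_assoc, ?pairing1, ?pairing2, comp_idr.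
  + rewrite <- comp_assoc, pairing1; apply comp_idr.
  + reflexivity.
Qed.

(** This square lets pullback stability carry regular epimorphisms through the functor, and relates
    [f] to its image in the proof of conservativity. *)
Lemma prod_functor_pullback (x y : A) (f : Hom x y) :
  is_pullback f (pr1 y) (pr1 x) (proj1_sig (fmap prod_functor f)).
Proof.
split; simpl.
- symmetry; apply pairing1.
- intros w u v e; exists (pairing u (pr2 y ∘ v)); split.
  + split; [apply pairing1|].
    apply pairing_ext; rewrite comp_assoc, ?pairing1, ?pairing2.
    * rewrite <- comp_assoc, pairing1; exact e.
    * reflexivity.
  + intros k [k1 k2].
    apply pairing_ext; rewrite ?pairing1, ?pairing2.
    * symmetry; exact k1.
    * rewrite <- k2, comp_assoc, pairing2; reflexivity.
Qed.

Lemma prod_functor_regular : regular_category A -> regular_functor prod_functor.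
Proof.
intros [hA [_ hs]]; split.
- apply right_adjoint_preserves_limits, prod_functor_right_adjoint.
- intros x y f hf; apply (slice_regular_epi _ hA).
  exact (hs _ _ _ _ _ _ _ _ (prod_functor_pullback f) hf).
Qed.

(** A monomorphism that is an extremal epimorphism is invertible. Both properties of [f] descend
    from the invertible image of [f] along the first projections. *)
Lemma prod_functor_conservative :
  (forall x, is_extremal_epi (pr1 x)) -> conservative prod_functor.
Proof.
intros hpr x y f hf.
assert (hi : is_iso (proj1_sig (fmap prod_functor f)))
  by exact (fmap_iso (slice_forget z) hf).
assert (hm : is_mono f).
(* As [pr1 w] is an epimorphism, it suffices to compare [u] and [v] after it; there they factor
   through the products with [z], where the image of [f] can be cancelled. *)
{ intros w u v e; apply (proj1 (hpr w)).
  transitivity (pr1 x ∘ pairing (u ∘ pr1 w) (pr2 w)); [symmetry; apply pairing1|].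
  transitivity (pr1 x ∘ pairing (v ∘ pr1 w) (pr2 w)); [|apply pairing1].
  f_equal; apply (pullback_ext (prod_functor_pullback f)).
  - destruct hi as [s [es _]].
    rewrite <- (comp_idl (pairing (u ∘ pr1 w) (pr2 w))).
    rewrite <- (comp_idl (pairing (v ∘ pr1 w) (pr2 w))).
    simpl in es |- *; rewrite <- es, <- !comp_assoc.
    do 2 f_equal; apply pairing_ext; rewrite !comp_assoc, ?pairing1, ?pairing2.
    + rewrite <- !comp_assoc, !pairing1, !comp_assoc, e; reflexivity.
    + reflexivity.
  - simpl; apply pairing_ext; rewrite !comp_assoc, ?pairing1, ?pairing2.
    + rewrite <- !comp_assoc, !pairing1, !comp_assoc, e; reflexivity.
    + reflexivity. }
assert (hx : is_extremal_epi f).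
{ apply (extremal_epi_of_comp (g := pr1 x)).
  rewrite (proj1 (prod_functor_pullback f)).
  apply extremal_epi_comp_iso; [apply hpr | exact hi]. }
apply (proj2 hx _ f (idm x) hm); symmetry; apply comp_idr.
Qed.

End ProductFunctor.

(** Indefinite description turns the existing pullbacks into product data. The first projections are
    pullbacks of the universal extremal epimorphism [m], which yields conservativity. *)
Lemma propointed_product_functor (A : Category) (z : A) :
  regular_category A -> propointed A -> is_initial z ->
  exists U : Functor A (Slice z),
    regular_functor U /\ conservative U /\ right_adjoint U.
Proof.
intros hA [_ [z' [t [m [hz' [ht hm]]]]]] hz.
destruct (initial_arr z' hz) as [a _], (initial_arr z hz') as [b _].
assert (to_t : forall x, { f : Hom x t | True })
  by (intro x; apply constructive_indefinite_description, terminal_arr, ht).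
pose (bang := fun x => proj1_sig (to_t x)).
(* [z] and [z'] are isomorphic, so a pullback along [m] is a product with [z]. *)
assert (hP : forall x, { p : { q : A & (Hom q x * Hom q z')%type } |
   is_pullback m (bang x) (snd (projT2 p)) (fst (projT2 p)) }).
{ intro x; apply constructive_indefinite_description.
  destruct (pullback_exists m (bang x) (proj1 hA)) as [q [q1 [q2 hq]]].
  exists (existT _ q (q2, q1)); exact hq. }
pose (P := fun x => projT1 (proj1_sig (hP x))).
pose (pr1 := fun x => fst (projT2 (proj1_sig (hP x))) : Hom (P x) x).
pose (pr2' := fun x => snd (projT2 (proj1_sig (hP x))) : Hom (P x) z').
assert (hpb : forall x, is_pullback m (bang x) (pr2' x) (pr1 x))
  by (intro x; exact (proj2_sig (hP x))).
assert (hpair : forall w x (f : Hom w x) (r : Hom w z),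
   { h : Hom w (P x) | pr1 x ∘ h = f /\ (b ∘ pr2' x) ∘ h = r }).
{ intros w x f r; apply constructive_indefinite_description.
  destruct (proj2 (hpb x) w (a ∘ r) f (terminal_ext _ _ ht)) as [h [[h1 h2] _]].
  exists h; split; [exact h2|].
  rewrite <- comp_assoc, h1, comp_assoc, (initial_ext (b ∘ a) (idm z) hz).
  apply comp_idl. }
assert (hext : forall w x (h h' : Hom w (P x)),
  pr1 x ∘ h = pr1 x ∘ h' -> (b ∘ pr2' x) ∘ h = (b ∘ pr2' x) ∘ h' -> h = h').
{ intros w x h h' e1 e2; apply (pullback_ext (hpb x)); [|exact e1].
  rewrite <- (comp_idl (pr2' x ∘ h)), <- (comp_idl (pr2' x ∘ h')).
  rewrite (initial_ext (idm z') (a ∘ b) hz'), <- !comp_assoc; f_equal.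
  rewrite !comp_assoc; exact e2. }
pose (pairing := fun w x (f : Hom w x) (r : Hom w z) => proj1_sig (hpair w x f r)).
assert (h1 : forall w x (f : Hom w x) (r : Hom w z), pr1 x ∘ pairing w x f r = f)
  by (intros; exact (proj1 (proj2_sig (hpair w x f r)))).
assert (h2 : forall w x (f : Hom w x) (r : Hom w z),
    (b ∘ pr2' x) ∘ pairing w x f r = r)
  by (intros; exact (proj2 (proj2_sig (hpair w x f r)))).
exists (prod_functor h1 h2 hext); split; [|split].
- apply prod_functor_regular, hA.
- apply prod_functor_conservative.
  intro x; exact (proj2 hm _ _ _ _ _ (hpb x)).
- apply prod_functor_right_adjoint.
Qed.

(** * Reflection of pronormality along a regular conservative functor *)

Section RegularConservative.
Variables (A X : Category) (U : Functor A X).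
Hypotheses (hA : regular_category A) (hX : normal X).
Hypotheses (hU : regular_functor U) (hC : conservative U).

Lemma conservative_propointed : has_initial A -> propointed A.
Proof.
intros [z hz]; split; [exact (proj1 hA)|].
destruct (terminal_exists (proj1 hA)) as [t ht].
destruct (initial_arr t hz) as [m _].
exists z, t, m; split; [exact hz | split; [exact ht|]].
assert (hUt := preserves_terminal (proj1 hU) ht).
destruct hX as [[o [oi ot]] _].
(* The composite through the zero object [o] is a section of [fmap U m], as [U t] is terminal. *)
destruct (terminal_arr (U t) ot) as [s1 _], (initial_arr (U z) oi) as [s2 _].
split.
- apply (reflects_split_epi (proj1 hU) (proj1 hA) hC (s := s2 ∘ s1)).
  apply terminal_ext, hUt.
- intros y p g p1 q hp.
  apply (preserves_pullback (proj1 hU)) in hp.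
  (* The section pulls back to a section of [fmap U q]. *)
  destruct (proj2 hp _ ((s2 ∘ s1) ∘ fmap U g) (idm (U y)) (terminal_ext _ _ hUt))
    as [s [[_ es] _]].
  exact (reflects_split_epi (proj1 hU) (proj1 hA) hC es).
Qed.

Lemma conservative_regular_epis_normal :
  has_initial A -> regular_epis_are_normal A.
Proof.
intros [z hz] B C g hg.
destruct (initial_arr C hz) as [i _].
destruct (pullback_exists g i (proj1 hA)) as [K [k [e hp]]].
exists z, i, K, k, e; split; [exact hz | split; [exact hp|]].
split; [exact (proj1 hp)|].
intros T u v huv.
destruct (proj2 (proj2 hX) _ _ _ (proj2 hU _ _ _ hg))
  as [o [i' [K' [k' [e' [ho [hp' hq']]]]]]].
destruct (initial_arr (U z) ho) as [j _].
(* The kernel [k'] of [fmap U g] in [X] factors through [fmap U k], even though [U z] need not be a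
   zero object. *)
destruct (proj2 (preserves_pullback (proj1 hU) hp) K' k' (j ∘ e'))
  as [l [[l1 l2] _]].
{ rewrite (proj1 hp'), comp_assoc; f_equal; apply initial_ext, ho. }
(* Thus [fmap U u] is trivial on that kernel and factors through [fmap U g] as [h]. *)
destruct (proj2 hq' (U T) (fmap U u) (fmap U v ∘ j)) as [h [[h1 _] _]].
{ rewrite <- l1, comp_assoc, <- fmap_comp, huv, fmap_comp, <- comp_assoc, l2.
  apply comp_assoc. }
assert (hepi := regular_epi_epi hg).
destruct hg as [w [a [b [hab hq]]]].
(* The factorization shows that [fmap U u] coequalizes the images of [a] and [b]; faithfulness
   brings this equality back to [A]. The factor [h] itself need not come from [A]. *)
destruct (hq T u) as [r [hr _]].
{ apply (conservative_faithful (proj1 hU) (proj1 hA) hC).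
  rewrite !fmap_comp, <- h1, <- !comp_assoc, <- !fmap_comp, hab; reflexivity. }
exists r; split.
- split; [exact hr | apply initial_ext, hz].
- intros r' [hr' _]; apply hepi; rewrite hr, hr'; reflexivity.
Qed.

End RegularConservative.

(** * The cycle of implications between the four conditions *)

Theorem theorem6p2 (A : Category) (hA : regular_category A) :
  (pronormal A <->
     propointed A /\ (forall z : A, is_initial z -> normal (Slice z))) /\
  (pronormal A <->
     exists (X : Category) (U : Functor A X),
       normal X /\ regular_functor U /\ conservative U /\ right_adjoint U) /\
  (pronormal A <->
     has_initial A /\
     exists (X : Category) (U : Functor A X),
       normal X /\ regular_functor U /\ conservative U).
Proof.
assert (h12 : pronormal A ->
  propointed A /\ (forall z : A, is_initial z -> normal (Slice z))).
{ intros [hp [_ hn]]; split; [exact hp|].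
  intros z hz; exact (slice_normal hz hA hn). }
assert (h23 : propointed A /\ (forall z : A, is_initial z -> normal (Slice z)) ->
  exists (X : Category) (U : Functor A X),
    normal X /\ regular_functor U /\ conservative U /\ right_adjoint U).
{ intros [hp hn].
  assert (hz := hp); destruct hz as [_ [z [_ [_ [hz _]]]]].
  destruct (propointed_product_functor hA hp hz) as [U hU].
  exists (Slice z), U; split; [exact (hn z hz) | exact hU]. }
assert (h34 : (exists (X : Category) (U : Functor A X),
    normal X /\ regular_functor U /\ conservative U /\ right_adjoint U) ->
  has_initial A /\ exists (X : Category) (U : Functor A X),
    normal X /\ regular_functor U /\ conservative U).
{ intros [X [U [hX [hU [hC [L [adj]]]]]]]; split; [|exists X, U; tauto].
  assert (ho := hX); destruct ho as [[o [ho _]] _].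
  (* The left adjoint sends the zero object of [X] to an initial object of [A]. *)
  exists (L o); exact (left_adjoint_initial adj ho). }
assert (h41 : (has_initial A /\ exists (X : Category) (U : Functor A X),
    normal X /\ regular_functor U /\ conservative U) -> pronormal A).
{ intros [hz [X [U [hX [hU hC]]]]]; split; [|split].
  - exact (conservative_propointed hA hX hU hC hz).
  - exact hA.
  - exact (conservative_regular_epis_normal hA hX hU hC hz). }
tauto.
Qed.
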